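(* Let $k\neq0$ be an admissible level. Let $M$ be an irreducible weight $V^k(\mathfrak{sl}_2)$-module, let $0\neq w\in M$ be an $\mathcal H^k$-highest vector, and put $L=N^k(\mathfrak{sl}_2)w$. Then $$\mathcal J_kL=0\quad\Longleftrightarrow\quad\mathcal I_kM=0.$$ Consequently, $L$ is an $N_k(\mathfrak{sl}_2)$-module if and only if $M$ is an $L_k(\mathfrak{sl}_2)$-module.
   Context: A level $k$ is admissible if $k+2=\frac uv$ with $u,v$ coprime positive integers and $u\ge2$. $V^k(\mathfrak{sl}_2)$ is the universal affine vertex algebra of level $k$ with generators $e,h,f$ ($h(z)h(w)\sim\frac{2k}{(z-w)^2}$, $h(z)e(w)\sim\frac{2e(w)}{z-w}$, $h(z)f(w)\sim-\frac{2f(w)}{z-w}$, $e(z)f(w)\sim\frac{k}{(z-w)^2}+\frac{h(w)}{z-w}$), $\mathcal I_k$ is its maximal ideal, and $L_k(\mathfrak{sl}_2)=V^k(\mathfrak{sl}_2)/\mathcal I_k$ its simple quotient. $\mathcal H^k$ is the Heisenberg vertex subalgebra generated by $h$; $N^k(\mathfrak{sl}_2)=\{a\in V^k(\mathfrak{sl}_2)\mid h(n)a=0\ \forall n\ge0\}$; $\mathcal J_k=\mathcal I_k\cap N^k(\mathfrak{sl}_2)$; $N_k(\mathfrak{sl}_2)=N^k(\mathfrak{sl}_2)/\mathcal J_k$. A weight module is one on which $h(0)$ acts semisimply. An $\mathcal H^k$-highest vector is a vector $w$ with $h(n)w=0$ for $n>0$ and $h(0)w\in\mathbb Cw$. $N^k(\mathfrak{sl}_2)w$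 is the $N^k(\mathfrak{sl}_2)$-submodule generated by $w$; for a subspace $A$ of a vertex algebra acting on $X$, ''$AX=0$'' means $a_nx=0$ for all $a\in A$, $x\in X$, $n\in\mathbb Z$. *)

(* Defs.v *)
From HB Require Import structures.
From mathcomp Require Import all_boot all_order all_algebra generic_quotient.
From mathcomp Require Import ring_quotient.
From mathcomp Require Import boolp classical_sets reals complex.

Set Implicit Arguments.
Unset Strict Implicit.
Unset Printing Implicit Defensive.

Import GRing.Theory Num.Theory.

Local Open Scope classical_set_scope.
Local Open Scope ring_scope.

Section Subspaces.
Variables (K : numFieldType) (V : lmodType K).

Definition is_subspace (S : set V) : Prop :=
  S 0 /\ forall (c : K) u v, S u -> S v -> S (c *: u + v).

Record subspace := Subspace {
  subspace_set :> set V;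
  subspaceP : is_subspace subspace_set }.

Definition subspace_mem (S : subspace) : {pred V} := fun v => `[< subspace_set S v >].

Lemma subspace_memP (S : subspace) v : reflect (subspace_set S v) (v \in subspace_mem S).
Proof. exact: asboolP. Qed.

Lemma subspace_mem_closed (S : subspace) : GRing.subsemimod_closed (subspace_mem S).
Proof.
have [S0 Sl] := subspaceP S.
split; first (split; first exact/subspace_memP).
  move=> u v /subspace_memP Su /subspace_memP Sv; apply/subspace_memP.
  by rewrite -[u]scale1r; apply: Sl.
move=> c v /subspace_memP Sv; apply/subspace_memP.
by rewrite -[_ *: _]addr0; apply: Sl.
Qed.

HB.instance Definition _ (S : subspace) :=
  GRing.isSubmodClosed.Build K V (subspace_mem S) (subspace_mem_closed S).

End Subspaces.

Section Subtype.
Variables (K : numFieldType) (V : lmodType K) (S : subspace V).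

Record sub_type := SubType { sub_val : V; _ : sub_val \in subspace_mem S }.

HB.instance Definition _ := [isSub for sub_val].
HB.instance Definition _ := [Choice of sub_type by <:].
HB.instance Definition _ := [SubChoice_isSubLmodule of sub_type by <:].

Lemma sub_valP (x : sub_type) : subspace_set S (val x).
Proof. exact/subspace_memP/valP. Qed.

Lemma sub_val_linear : linear sub_val.
Proof. exact: (linearP (val : sub_type -> V)). Qed.

Lemma sub_val0 : sub_val 0 = 0.
Proof. exact: (raddf0 (val : sub_type -> V)). Qed.

Definition sub_elt (v : V) (Sv : subspace_set S v) : sub_type :=
  @SubType v (introT (subspace_memP S v) Sv).

End Subtype.

Section QuotientSpace.
Local Open Scope quotient_scope.
Variables (K : numFieldType) (V : lmodType K) (S : subspace V).

Definition quot_type := (Quotient.quot (subspace_mem S)).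
HB.instance Definition _ := GRing.Zmodule.on quot_type.

Definition quot_pi : V -> quot_type := \pi_(Quotient.quot (subspace_mem S)).
Definition quot_repr : quot_type -> V := @repr _ (Quotient.quot (subspace_mem S)).

Lemma quot_reprK : cancel quot_repr quot_pi.
Proof. exact: (@reprK _ (Quotient.quot (subspace_mem S))). Qed.

Lemma quot_piP (u v : V) : quot_pi u = quot_pi v <-> subspace_set S (u - v).
Proof.
split=> [e|Suv].
  by apply/subspace_memP; rewrite Quotient.idealrBE; apply/eqP.
by apply/eqP; rewrite /quot_pi -Quotient.idealrBE; apply/subspace_memP.
Qed.

Lemma quot_piD : {morph quot_pi : u v / u + v}.
Proof. by move=> u v; rewrite /quot_pi !piE. Qed.

Definition quot_scale (c : K) (x : quot_type) : quot_type :=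
  quot_pi (c *: quot_repr x).

Lemma quot_piZ_subproof c v : quot_scale c (quot_pi v) = quot_pi (c *: v).
Proof.
apply/quot_piP; rewrite -scalerBr.
have /quot_piP Sd : quot_pi (quot_repr (quot_pi v)) = quot_pi v.
  exact: quot_reprK.
by rewrite -[_ *: _]addr0; apply: (subspaceP S).2 => //; apply: (subspaceP S).1.
Qed.

Lemma quot_scalerA a b (x : quot_type) :
  quot_scale a (quot_scale b x) = quot_scale (a * b) x.
Proof. by rewrite -[x]quot_reprK !quot_piZ_subproof scalerA. Qed.

Lemma quot_scale1r : left_id 1 quot_scale.
Proof. by move=> x; rewrite -[x]quot_reprK quot_piZ_subproof scale1r. Qed.

Lemma quot_scalerDr : right_distributive quot_scale +%R.
Proof.
move=> c x y; rewrite -[x]quot_reprK -[y]quot_reprK -quot_piD.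
by rewrite !quot_piZ_subproof scalerDr quot_piD.
Qed.

Lemma quot_scalerDl (x : quot_type) :
  {morph quot_scale^~ x : a b / a + b}.
Proof.
move=> a b; rewrite -[x]quot_reprK !quot_piZ_subproof.
by rewrite scalerDl quot_piD.
Qed.

HB.instance Definition _ := GRing.Zmodule_isLmodule.Build K quot_type
  quot_scalerA quot_scale1r quot_scalerDr quot_scalerDl.

Lemma quot_pi_linear : linear quot_pi.
Proof. by move=> c u v; rewrite quot_piD -quot_piZ_subproof. Qed.

HB.instance Definition _ :=
  GRing.isLinear.Build K V quot_type _ quot_pi quot_pi_linear.

End QuotientSpace.

Definition int_binomial (K : numFieldType) (p : int) (i : nat) : K :=
  (\prod_(j < i) (p%:~R - j%:R)) / (i`!)%:R.

(* [Y a n b] stands for a_(n) b, with a(z) = \sum_n a_(n) z^(-n-1).  The sums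
   of the Borcherds (Jacobi) identity have finitely many nonzero terms by
   truncation; they are written as their partial sums over i < N, N large. *)
Definition borcherds (K : numFieldType) (V M : lmodType K)
    (Y : V -> int -> V -> V) (act : V -> int -> M -> M) : Prop :=
  forall (a b : V) (x : M) (p q r : int),
  exists N0 : nat, forall N : nat, (N0 <= N)%N ->
    \sum_(i < N) int_binomial K p i *: act (Y a (r + i%:Z) b) (p + q - i%:Z) x =
    \sum_(i < N) ((-1) ^+ i * int_binomial K r i) *:
      (act a (p + r - i%:Z) (act b (q + i%:Z) x)
       - (-1 : K) ^ r *: act b (q + r - i%:Z) (act a (p + i%:Z) x)).

Record is_va_module (K : numFieldType) (V M : lmodType K)
    (Y : V -> int -> V -> V) (vac : V) (act : V -> int -> M -> M) : Prop := {
  act_linear_l : forall n x, linear (fun a => act a n x);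
  act_linear_r : forall a n, linear (act a n);
  act_truncation : forall a x, exists N : int,
    forall n : int, N <= n -> act a n x = 0;
  act_vacuum : forall n x, act vac n x = if n == -1 then x else 0;
  act_borcherds : borcherds Y act }.

Record is_vertex_algebra (K : numFieldType) (V : lmodType K)
    (Y : V -> int -> V -> V) (vac : V) : Prop := {
  va_adjoint : is_va_module Y vac Y;
  va_creation : forall a, Y a (-1) vac = a;
  va_creation_regular : forall a (n : int), 0 <= n -> Y a n vac = 0 }.

Record vertexAlg (K : numFieldType) := VertexAlg {
  va_sort :> lmodType K;
  nprod : va_sort -> int -> va_sort -> va_sort;
  vacuum : va_sort;
  vaP : is_vertex_algebra nprod vacuum }.

Arguments nprod {K v} a n b.
Arguments vacuum {K} v.

(* No grading and no conformal vector is required of a module. *)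
Record vaModule (K : numFieldType) (V : vertexAlg K) := VaModule {
  vm_sort :> lmodType K;
  act : V -> int -> vm_sort -> vm_sort;
  vmP : is_va_module nprod (vacuum V) act }.

Arguments act {K V v} a n x.

Record is_va_morphism (K : numFieldType) (V W : vertexAlg K) (phi : V -> W) :
    Prop := {
  va_morphism_linear : linear phi;
  va_morphism_vacuum : phi (vacuum V) = vacuum W;
  va_morphism_nprod : forall a n b, phi (nprod a n b) = nprod (phi a) n (phi b) }.

Record is_subva (K : numFieldType) (V : vertexAlg K) (S : set V) : Prop := {
  subva_subspace : is_subspace S;
  subva_vacuum : S (vacuum V);
  subva_nprod : forall a n b, S a -> S b -> S (nprod a n b) }.

Record subva (K : numFieldType) (V : vertexAlg K) := Subva {
  subva_set :> set V;
  subvaP : is_subva subva_set }.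

Section SubvaAlg.
Variables (K : numFieldType) (V : vertexAlg K) (S : subva V).

Definition subva_sp : subspace V := Subspace (subva_subspace (subvaP S)).

Definition subva_nprod_sub (a : sub_type subva_sp) (n : int)
    (b : sub_type subva_sp) : sub_type subva_sp :=
  @sub_elt _ _ subva_sp _
    (subva_nprod (subvaP S) n (sub_valP a) (sub_valP b)).

Definition subva_vacuum_sub : sub_type subva_sp :=
  @sub_elt _ _ subva_sp _ (subva_vacuum (subvaP S)).

Lemma restrict_is_va_module (M : vaModule V) :
  is_va_module subva_nprod_sub subva_vacuum_sub
    (fun a n (x : M) => act (val a) n x).
Proof.
have [ll lr tr va bo] := vmP M.
split=> [n x|a n|a x|n x|a b x p q r].
- by move=> c a b; rewrite linearP ll.
- exact: lr.
- exact: tr.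
- exact: va.
- exact: bo.
Qed.

Lemma subva_is_vertex_algebra :
  is_vertex_algebra subva_nprod_sub subva_vacuum_sub.
Proof.
have [[ll lr tr va bo] cr crr] := vaP V.
split=> [|a|a n n0]; last 2 first.
- by apply: val_inj; rewrite /= cr.
- by apply: val_inj; rewrite /= crr // sub_val0.
split=> [n x|a n|a x|n x|a b x p q r].
- by move=> c a b; apply: val_inj; rewrite /=; apply: ll.
- by move=> c x y; apply: val_inj; rewrite /=; apply: lr.
- have [N trN] := tr (val a) (val x); exists N => n Nn.
  by apply: val_inj; rewrite /= trN // sub_val0.
- by apply: val_inj; rewrite /= va; case: ifP => // _; rewrite sub_val0.
- have [N0 boN] := bo (val a) (val b) (val x) p q r; exists N0 => N NN.
  by apply: val_inj; rewrite !raddf_sum /=; apply: boN.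
Qed.

Definition subva_alg : vertexAlg K := VertexAlg subva_is_vertex_algebra.

Definition res_module (M : vaModule V) : vaModule subva_alg :=
  @VaModule K subva_alg M _ (restrict_is_va_module M).

End SubvaAlg.

Record is_submodule (K : numFieldType) (V : vertexAlg K) (M : vaModule V)
    (S : set M) : Prop := {
  submodule_subspace : is_subspace S;
  submodule_act : forall (a : V) n x, S x -> S (act a n x) }.

Record submodule (K : numFieldType) (V : vertexAlg K) (M : vaModule V) :=
  Submodule {
    submodule_set :> set M;
    submoduleP : is_submodule submodule_set }.

Section SubmoduleMod.
Variables (K : numFieldType) (V : vertexAlg K) (M : vaModule V).
Variable S : submodule M.

Definition submodule_sp : subspace M :=
  Subspace (submodule_subspace (submoduleP S)).

Definition submodule_act_sub (a : V) (n : int) (x : sub_type submodule_sp) :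
    sub_type submodule_sp :=
  @sub_elt _ _ submodule_sp _ (submodule_act (submoduleP S) a n (sub_valP x)).

Lemma submodule_is_va_module :
  is_va_module nprod (vacuum V) submodule_act_sub.
Proof.
have [ll lr tr va bo] := vmP M.
split=> [n x|a n|a x|n x|a b x p q r].
- by move=> c a b; apply: val_inj; rewrite /=; apply: ll.
- by move=> c x y; apply: val_inj; rewrite /=; apply: lr.
- have [N trN] := tr a (val x); exists N => n Nn.
  by apply: val_inj; rewrite /= trN // sub_val0.
- by apply: val_inj; rewrite /= va; case: ifP => // _; rewrite sub_val0.
- have [N0 boN] := bo a b (val x) p q r; exists N0 => N NN.
  by apply: val_inj; rewrite !raddf_sum /=; apply: boN.
Qed.

Definition submodule_mod : vaModule V := VaModule submodule_is_va_module.

End SubmoduleMod.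

Section GeneratedSubmodule.
Variables (K : numFieldType) (V : vertexAlg K) (M : vaModule V) (w : M).

Definition generated_set : set M :=
  [set x | forall S : set M, is_submodule S -> S w -> S x].

Lemma generated_is_submodule : is_submodule generated_set.
Proof.
split; first split.
- by move=> S sS _; have [] := submodule_subspace sS.
- move=> c u v gu gv S sS Sw; have [_ +] := submodule_subspace sS.
  by apply; [apply: gu|apply: gv].
- by move=> a n x gx S sS Sw; apply: submodule_act => //; apply: gx.
Qed.

Definition generated_submodule : submodule M :=
  Submodule generated_is_submodule.

End GeneratedSubmodule.

Definition irreducible (K : numFieldType) (V : vertexAlg K) (M : vaModule V) :
    Prop :=
  (exists x : M, x != 0) /\
  forall S : set M, is_submodule S -> S = [set 0] \/ S = setT.

Record is_ideal (K : numFieldType) (V : vertexAlg K) (I : set V) : Prop := {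
  ideal_subspace : is_subspace I;
  ideal_nprod_l : forall a n b, I b -> I (nprod a n b);
  ideal_nprod_r : forall a n b, I a -> I (nprod a n b) }.

Record ideal (K : numFieldType) (V : vertexAlg K) := Ideal {
  ideal_set :> set V;
  idealP : is_ideal ideal_set }.

Definition is_maximal_ideal (K : numFieldType) (V : vertexAlg K) (I : ideal V) :
    Prop :=
  (I : set V) <> setT /\
  forall J : ideal V, I `<=` J -> (J : set V) = I \/ (J : set V) = setT.

Section QuotientAlg.
Variables (K : numFieldType) (V : vertexAlg K) (I : ideal V).

Definition ideal_sp : subspace V := Subspace (ideal_subspace (idealP I)).

Definition quot_nprod (x : quot_type ideal_sp) (n : int)
    (y : quot_type ideal_sp) : quot_type ideal_sp :=
  quot_pi ideal_sp (nprod (quot_repr x) n (quot_repr y)).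

Lemma quot_nprod_pi (a : V) (n : int) (b : V) :
  quot_nprod (quot_pi ideal_sp a) n (quot_pi ideal_sp b) =
  quot_pi ideal_sp (nprod a n b).
Proof.
have [[ll lr _ _ _] _ _] := vaP V.
have subl u v m x : nprod (u - v) m x = nprod u m x - nprod v m x :> V.
  by have := ll m x (-1) v u; rewrite !scaleN1r ![- _ + _]addrC.
have subr x m u v : nprod x m (u - v) = nprod x m u - nprod x m v :> V.
  by have := lr x m (-1) v u; rewrite !scaleN1r ![- _ + _]addrC.
have rep u : ideal_set I (quot_repr (quot_pi ideal_sp u) - u).
  by apply/(quot_piP ideal_sp); rewrite quot_reprK.
apply/quot_piP; rewrite /=.
set a' := quot_repr _; set b' := quot_repr _.
have -> : nprod a' n b' - nprod a n b =
    1 *: nprod (a' - a) n b' + nprod a n (b' - b).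
  by rewrite scale1r subl subr addrA subrK.
apply: (ideal_subspace (idealP I)).2.
  by apply: ideal_nprod_r; [exact: idealP|exact: rep].
by apply: ideal_nprod_l; [exact: idealP|exact: rep].
Qed.

Lemma quot_is_vertex_algebra :
  is_vertex_algebra quot_nprod (quot_pi ideal_sp (vacuum V)).
Proof.
have [[ll lr tr va bo] cr crr] := vaP V.
split=> [|x|x n n0]; last 2 first.
- by rewrite -[x]quot_reprK quot_nprod_pi cr.
- by rewrite -[x]quot_reprK quot_nprod_pi crr // raddf0.
split=> [n x|x n|x y|n x|x y z p q r].
- move=> c a b; rewrite -[x]quot_reprK -[a]quot_reprK -[b]quot_reprK.
  by rewrite -linearP !quot_nprod_pi ll linearP.
- move=> c a b; rewrite -[x]quot_reprK -[a]quot_reprK -[b]quot_reprK.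
  by rewrite -linearP !quot_nprod_pi lr linearP.
- have [N trN] := tr (quot_repr x) (quot_repr y); exists N => n Nn.
  by rewrite -[x]quot_reprK -[y]quot_reprK quot_nprod_pi trN // raddf0.
- rewrite -[x]quot_reprK quot_nprod_pi va.
  by case: ifP => // _; rewrite raddf0.
- have [N0 boN] := bo (quot_repr x) (quot_repr y) (quot_repr z) p q r.
  exists N0 => N /boN /(congr1 (quot_pi ideal_sp)); rewrite !raddf_sum /=.
  under eq_bigr => i _ do rewrite linearZ /= -!quot_nprod_pi !quot_reprK.
  move=> ->; apply: eq_bigr => i _.
  by rewrite linearZ /= linearB /= linearZ /= -!quot_nprod_pi !quot_reprK.
Qed.

Definition quotva : vertexAlg K := VertexAlg quot_is_vertex_algebra.

Definition quotva_proj : V -> quotva := quot_pi ideal_sp.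

(* X, with its given V-module structure, is a V/I-module *)
Definition is_quot_module (X : vaModule V) : Prop :=
  exists act' : quotva -> int -> X -> X,
    is_va_module nprod (vacuum quotva) act' /\
    forall (a : V) n (x : X), act' (quotva_proj a) n x = act a n x.

End QuotientAlg.

Definition annihilates (K : numFieldType) (V : vertexAlg K) (M : vaModule V)
    (A : set V) (X : set M) : Prop :=
  forall a x n, A a -> X x -> act a n x = 0.

(* the ideal I \cap S of the vertex subalgebra S *)
Section IdealSubva.
Variables (K : numFieldType) (V : vertexAlg K) (I : ideal V) (S : subva V).

Definition ideal_subva_set : set (subva_alg S) := [set a | ideal_set I (val a)].

Lemma ideal_subva_is_ideal : is_ideal ideal_subva_set.
Proof.
have [[I0 Il] Ill Ilr] := idealP I.
split; first split.
- exact: I0.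
- by move=> c u v Iu Iv; apply: Il.
- by move=> a n b Ib; apply: Ill.
- by move=> a n b Ia; apply: Ilr.
Qed.

Definition ideal_subva : ideal (subva_alg S) := Ideal ideal_subva_is_ideal.

End IdealSubva.

Section Commutant.
Variables (K : numFieldType) (V : vertexAlg K) (h : V).

Definition commutant_set : set V :=
  [set a | forall n : nat, nprod h n%:Z a = 0].

Lemma commutant_is_subva : is_subva commutant_set.
Proof.
have [[ll lr tr va bo] cr crr] := vaP V.
have zr (a : V) n : nprod a n 0 = 0 :> V.
  by have := lr a n (-1) 0 0; rewrite !scaleN1r oppr0 addr0 addNr.
have zl (x : V) n : nprod 0 n x = 0 :> V.
  by have := ll n x (-1) 0 0; rewrite !scaleN1r oppr0 addr0 addNr.
split; first split.
- by move=> n; exact: zr.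
- by move=> c u v hu hv n; rewrite lr hu hv scaler0 addr0.
- by move=> n; rewrite crr.
move=> a m b ha hb n.
have [N0 /(_ N0.+1 (leqnSn _))] := bo h a b n%:Z m 0.
rewrite big1 => [|i _]; last by rewrite add0r ha zl scaler0.
rewrite big_ord_recl big1 => [|i _]; last first.
  have -> : int_binomial K 0 (lift ord0 i) = 0.
    by rewrite /int_binomial big_ord_recl /= subr0 !mul0r.
  by rewrite mulr0 scale0r.
rewrite addr0 /= /int_binomial big_ord0 fact0 divr1 expr0 mulr1 scale1r.
by rewrite (_ : Posz (@ord0 N0) = 0) // ?(subr0, addr0) expr0z scale1r hb zr subr0 => <-.
Qed.

Definition commutant : subva V := Subva commutant_is_subva.

End Commutant.

Section AffineSl2.
Variable K : numFieldType.
Implicit Types (k : K) (V W : vertexAlg K).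

(* The singular part of a(z)b(w) is \sum_(n >= 0) a_(n) b (w) / (z - w)^(n+1),
   so an OPE prescribes the products a_(n) b for n >= 0. *)
Record affine_sl2_ope V k (e h f : V) : Prop := {
  ope_hh : forall n : nat,
    nprod h n%:Z h = if n == 1%N then (2 * k) *: vacuum V else 0;
  ope_he : forall n : nat, nprod h n%:Z e = if n == 0%N then 2 *: e else 0;
  ope_hf : forall n : nat, nprod h n%:Z f = if n == 0%N then - (2 *: f) else 0;
  ope_ef : forall n : nat,
    nprod e n%:Z f =
      if n == 0%N then h else if n == 1%N then k *: vacuum V else 0;
  ope_ee : forall n : nat, nprod e n%:Z e = 0;
  ope_ff : forall n : nat, nprod f n%:Z f = 0 }.

(* The pair (V, (e, h, f)) is determined up to a unique isomorphism: the
   morphism in the universal property is unique since e, h, f generate V. *)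
Record is_universal_affine_sl2 V k (e h f : V) : Prop := {
  universal_ope : affine_sl2_ope k e h f;
  universal_generated : forall S : set V,
    is_subva S -> S e -> S h -> S f -> S = setT;
  universal_morphism : forall W (e' h' f' : W), affine_sl2_ope k e' h' f' ->
    exists phi : V -> W,
      [/\ is_va_morphism phi, phi e = e', phi h = h' & phi f = f'] }.

Definition admissible k : Prop :=
  exists u v : nat,
    [/\ (2 <= u)%N, (0 < v)%N, coprime u v & k + 2 = u%:R / v%:R].

(* h_(0) acts semisimply: M is spanned by eigenvectors of h_(0) *)
Definition weight_module V (h : V) (M : vaModule V) : Prop :=
  forall x : M, exists s : seq M,
    (forall y, y \in s -> exists c : K, act h 0 y = c *: y) /\
    x = \sum_(y <- s) y.

Definition heisenberg_highest V (h : V) (M : vaModule V) (w : M) : Prop :=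
  (forall n : nat, (0 < n)%N -> act h n%:Z w = 0) /\
  exists c : K, act h 0 w = c *: w.

End AffineSl2.

(* Main.v *)
Require Import Defs.
From HB Require Import structures.
From mathcomp Require Import all_boot all_order all_algebra.
From mathcomp Require Import boolp classical_sets reals complex.
From mathcomp Require Import zify.

Set Implicit Arguments.
Unset Strict Implicit.
Unset Printing Implicit Defensive.

Import Order.TTheory GRing.Theory Num.Theory.

Local Open Scope classical_set_scope.
Local Open Scope ring_scope.
Local Open Scope complex_scope.

(**
Only one implication has content: if J = I /\ N kills L, then I kills M.

Since M is irreducible and { x | I x = 0 } is a submodule
([act_kernel_ideal_submodule]), it is enough to prove I w = 0.  The products
a_(n) w with a in I span a submodule as well ([ideal_orbit_submodule]), so if I
w <> 0, then they span M, and in particular w is a combination of them.  Let c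
be the h_(0)-eigenvalue of w.  The algebra V is spanned by h_(0)-eigenvectors,
hence a = a0 + a' with a0 in I of weight 0 and a' without component of weight 0
([h0_semisimple], [off_spectrum_split]).  Then a'_(n) w has no component of
eigenvalue c.  Once a0_(n) w = 0 is known, all a_(n) w with a in I lie in the
space of vectors without such a component, and this space excludes w.

That a0_(n) w = 0 for a0 of weight 0 in I is the heart of the proof
([weight0_annihilates]).  For k <> 0 the Heisenberg algebra spanned by the modes
of h acts on the weight-0 part of I.  Each vector there is killed by all
products of modes h_(n), n > 0, of large total degree, and such a representation
is generated by its vacuum vectors ([heisenberg_reduction]).  The vacuum vectors
are the elements of I that are killed by all h_(n), n >= 0, that is, the
elements of J.  So the weight-0 part of I is obtained from J by applying modes
of h.  The vectors of M killed by J form a space X that contains w and is stable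
under the modes of h, because these commute with the modes of J
([act_kernel_commutant]); by associativity, the elements of V all of whose modes
kill X are again stable under the modes of h ([annihilator_nprod]).  As they
include J, they include the weight-0 part of I.

That products of positive modes of h of large degree vanish reflects the
conformal grading of V.  As V is given by generators, the grading is replaced by
the filtration by the degrees of words in the modes of e, h, f applied to the
vacuum; a word of negative conformal weight vanishes because a mode that lowers
the weight can be commuted to the right until it meets the vacuum
([word_eval_pos]).

The equivalence about quotient modules follows, since a V-module is a module
over V/I exactly when I kills it ([is_quot_moduleP]).
*)

(** * Subspaces *)

Section SubspaceClosure.
Variables (K : numFieldType) (U : lmodType K) (S : set U).
Hypothesis sS : is_subspace S.

Lemma subspace0 : S 0. Proof. exact: sS.1. Qed.

Lemma subspaceZ c u : S u -> S (c *: u).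
Proof.
by move=> Su; rewrite -[_ *: _]addr0; apply: sS.2 => //; apply: subspace0.
Qed.

Lemma subspaceD u v : S u -> S v -> S (u + v).
Proof. by move=> Su Sv; rewrite -[u]scale1r; apply: sS.2. Qed.

Lemma subspaceN u : S u -> S (- u).
Proof. by move=> Su; rewrite -scaleN1r; apply: subspaceZ. Qed.

Lemma subspaceB u v : S u -> S v -> S (u - v).
Proof. by move=> Su Sv; apply: subspaceD => //; apply: subspaceN. Qed.

Lemma subspace_sum (T : Type) (r : seq T) (F : T -> U) :
  (forall i, S (F i)) -> S (\sum_(i <- r) F i).
Proof.
move=> SF; elim/big_rec: _ => [|i u _]; first exact: subspace0.
exact: subspaceD.
Qed.

End SubspaceClosure.

Lemma zero_subspace (K : numFieldType) (U : lmodType K) :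
  is_subspace [set 0 : U].
Proof. by split=> // c u v /= -> ->; rewrite scaler0 addr0. Qed.

Lemma preim_subspace (K : numFieldType) (U W : lmodType K)
    (T : {linear U -> W}) (S : set W) :
  is_subspace S -> is_subspace [set u | S (T u)].
Proof.
move=> sS; split=> [|c u v Su Sv] /=; first by rewrite raddf0; apply: subspace0.
by rewrite linearP; apply: sS.2.
Qed.

(** * Elements without a component of a given eigenvalue *)

Section SpectralPolynomials.
Variables (K : numFieldType) (U : lmodType K) (T : {linear U -> U}).

(** The polynomial in [T] with roots [s], applied to [x]. *)
Definition root_prod (s : seq K) (x : U) : U :=
  foldr (fun l y => T y - l *: y) x s.

Lemma root_prod_linear s : linear (root_prod s).
Proof.
move=> c u v; elim: s => //= l s ->.
rewrite linearP !scalerDr !opprD scalerN scalerA mulrC -scalerA.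
by rewrite [LHS]addrACA.
Qed.

HB.instance Definition _ s :=
  GRing.isLinear.Build K U U _ (root_prod s) (root_prod_linear s).

Lemma root_prod_T s x : root_prod s (T x) = T (root_prod s x).
Proof.
by elim: s => //= l s ->; rewrite linearB [T (_ *: _)]linearZ.
Qed.

Lemma root_prodC s t x :
  root_prod s (root_prod t x) = root_prod t (root_prod s x).
Proof.
by elim: t => //= l t IH; rewrite linearB [X in _ - X]linearZ /= root_prod_T IH.
Qed.

Lemma root_prod_eigen s c x :
  T x = c *: x -> root_prod s x = (\prod_(l <- s) (c - l)) *: x.
Proof.
move=> Tx; elim: s => [|l s IH] /=; first by rewrite big_nil scale1r.
rewrite IH big_cons linearZ /= Tx !scalerA -scalerBl; congr (_ *: _).
by rewrite mulrBl [c * _]mulrC.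
Qed.

Lemma prod_roots_neq0 (s : seq K) c : c \notin s -> \prod_(l <- s) (c - l) != 0.
Proof.
move=> cs; rewrite prodf_seq_neq0; apply/allP => l ls /=.
by rewrite subr_eq0; apply: contraNneq cs => ->.
Qed.

(** For diagonalizable [T] these are the vectors whose component of eigenvalue
    [c] vanishes.  The annihilating polynomial makes it possible to speak of
    this component before any decomposition into eigenvectors is known. *)
Definition off_spectrum (c : K) : set U :=
  [set x | exists2 s : seq K, c \notin s & root_prod s x = 0].

Lemma off_spectrum_subspace c : is_subspace (off_spectrum c).
Proof.
split=> [|a u v [s cs su] [t ct tv]]; first by exists [::].
exists (s ++ t); first by rewrite mem_cat negb_or cs.
have cat y : root_prod (s ++ t) y = root_prod s (root_prod t y).
  exact: foldr_cat.
by rewrite linearP /= !cat tv root_prodC su !linear0 addr0.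
Qed.

Lemma off_spectrum_eigen c x : T x = c *: x -> off_spectrum c x -> x = 0.
Proof.
move=> Tx [s cs]; rewrite (root_prod_eigen _ Tx) => /eqP.
by rewrite scaler_eq0 (negbTE (prod_roots_neq0 cs)) => /eqP.
Qed.

(** If the polynomial p with p(0) <> 0 kills [T x], then p(T)/p(0) is the
    projection of [x] to the kernel of [T].  It is a polynomial in [T], so the
    projection does not leave a [T]-stable subspace. *)
Lemma off_spectrum_split (P : set U) x :
  is_subspace P -> (forall y, P y -> P (T y)) -> P x -> off_spectrum 0 (T x) ->
  exists x0 x', [/\ x = x0 + x', P x0, T x0 = 0 & off_spectrum 0 x'].
Proof.
move=> sP PT Px [s s0 sTx].
have Ps t : P (root_prod t x).
  elim: t => //= l t IH; apply: subspaceB => //; first exact: PT.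
  exact: subspaceZ.
set d := \prod_(l <- s) (0 - l).
have d0 : d != 0 by apply: prod_roots_neq0.
have Tx0 : T (d^-1 *: root_prod s x) = 0.
  by rewrite linearZ /= -root_prod_T sTx scaler0.
exists (d^-1 *: root_prod s x), (x - d^-1 *: root_prod s x); split=> //.
- by rewrite addrCA subrr addr0.
- exact: subspaceZ.
exists s => //; rewrite linearB /=.
rewrite (root_prod_eigen (c := 0) s (x := d^-1 *: _)) ?Tx0 ?scale0r //.
by rewrite -/d scalerA divff // scale1r subrr.
Qed.

End SpectralPolynomials.

(** * Representations of the Heisenberg algebra *)

Section HeisenbergReduction.
Variables (K : numFieldType) (U : lmodType K) (T : int -> {linear U -> U}).
Variables (kappa : K) (Fil : int -> set U) (P Y : set U).
Hypothesis kappa0 : kappa != 0.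
Hypothesis T_comm : forall m n x,
  T m (T n x) = T n (T m x) + (if m + n == 0 then kappa * m%:~R else 0) *: x.
Hypothesis Fil_subspace : forall D, is_subspace (Fil D).
Hypothesis Fil_T : forall D n x, Fil D x -> Fil (D - n) (T n x).
Hypothesis Fil_neg : forall D x, D < 0 -> Fil D x -> x = 0.
Hypothesis P_subspace : is_subspace P.
Hypothesis P_T : forall n x, P x -> P (T n x).
Hypothesis Y_subspace : is_subspace Y.
Hypothesis Y_T : forall n x, Y x -> Y (T n x).
Hypothesis Y_vacuum : forall x, P x -> (forall n : nat, T n%:Z x = 0) -> Y x.

Let T_iter_comm (n : nat) s x :
  iter s (T n) (T (- n%:Z) x) =
  T (- n%:Z) (iter s (T n) x) + (s%:R * (kappa * n%:R)) *: iter s.-1 (T n) x.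
Proof.
elim: s => [|s IH]; first by rewrite mul0r scale0r addr0.
rewrite iterS IH linearD linearZ /= T_comm subrr eqxx -addrA; congr (_ + _).
case: s {IH} => [|s] /=.
  by rewrite mul0r scale0r addr0 mul1r.
by rewrite -scalerDl; congr (_ *: _); rewrite [in RHS]mulrSr mulrDl mul1r addrC.
Qed.

Let T_commute m n x : m + n != 0 -> T m (T n x) = T n (T m x).
Proof. by move=> /negbTE mn; rewrite T_comm mn scale0r addr0. Qed.

Let T_sub n u c v : T n (u - c *: v) = T n u - c *: T n v.
Proof. by rewrite raddfB /= linearZ_LR. Qed.

Let T_zero n : T n 0 = 0.
Proof. exact: raddf0. Qed.

Let T0_comm n x : T 0 (T n x) = T n (T 0 x).
Proof. by rewrite T_comm mulr0z mulr0 if_same scale0r addr0. Qed.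

(** The subspace [Y] contains the vacuum vectors of [P] and is stable under the
    operators [T n].  To bring [x] into [Y], it is made a vacuum vector by
    corrections of the form T(-n) T(n) x, which lie in [Y] by induction on the
    level of the filtration, T(n) x having smaller level.  The operators T(n)
    are treated from large n down to 1; for each n, one correction lowers by one
    the power of T(n) that kills [x]. *)
Lemma heisenberg_reduction D x : Fil D x -> P x -> T 0 x = 0 -> Y x.
Proof.
have [d Dd] : exists d : nat, D < d%:Z by exists (`|D|%N).+1; lia.
elim: d D Dd x => [|d IHd] D Dd x Fx Px T0x.
  by rewrite (Fil_neg _ Fx) //; apply: subspace0.
have : forall n : nat, (d < n)%N -> T n x = 0.
  by move=> n dn; apply: (@Fil_neg (D - n%:Z)); [lia|apply: Fil_T].
(* [j]: the operators T(n) with n > j already kill [x]. *)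
move: {1}d => j; elim: j x Fx Px T0x => [|j IHj] x Fx Px T0x Tx.
  by apply: Y_vacuum => // -[|n] //; apply: Tx.
(* Each T(j+1) lowers the level, which is at most [d]. *)
have [s sx] : exists s, iter s.+1 (T j.+1) x = 0.
  exists d.
  have Fit t : Fil (D - t%:Z * j.+1%:Z) (iter t (T j.+1) x).
    elim: t => [|t IHt]; first by rewrite mul0r subr0.
    have := Fil_T j.+1 IHt; congr (Fil _ _); lia.
  by apply: Fil_neg (Fit _); nia.
elim: s x Fx Px T0x Tx sx => [|s IHs] x Fx Px T0x Tx sx.
  apply: IHj => // n; rewrite leq_eqVlt => /orP[/eqP <- //|]; exact: Tx.
set y := T (- j.+1%:Z) (T j.+1 x).
(* [c] cancels the scalar in T(n)^s.+1 T(-n) T(n) x = c^-1 T(n)^s.+1 x, which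
   holds because T(n)^s.+2 kills [x]. *)
set c := (s.+1%:R * (kappa * j.+1%:R))^-1.
have c0 : s.+1%:R * (kappa * j.+1%:R) != 0.
  by rewrite !mulf_neq0 // pnatr_eq0.
have Yy : Y y.
  apply: Y_T; apply: (IHd (D - j.+1%:Z)); [lia|exact: Fil_T|exact: P_T|].
  by rewrite T0_comm T0x T_zero.
have -> : x = (x - c *: y) + c *: y by rewrite subrK.
apply: subspaceD => //; last exact: subspaceZ.
apply: IHs.
- apply: subspaceB => //; apply: subspaceZ => //.
  by have := Fil_T (- j.+1%:Z) (Fil_T j.+1 Fx); rewrite opprK subrK.
- by apply: subspaceB => //; apply: subspaceZ => //; do 2!apply: P_T.
- by rewrite T_sub T0x /y !T0_comm T0x !T_zero scaler0 subr0.
- move=> n jn; rewrite T_sub Tx // /y T_commute; last by lia.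
  by rewrite [T n (T _ x)]T_commute ?Tx ?T_zero ?scaler0 ?subr0 //; lia.
have itB t u v : iter t (T j.+1) (u - c *: v) =
    iter t (T j.+1) u - c *: iter t (T j.+1) v.
  by elim: t => //= t ->; rewrite T_sub.
rewrite itB /y T_iter_comm -iterSr sx T_zero add0r scalerA mulVf // scale1r.
by rewrite -iterSr subrr.
Qed.

End HeisenbergReduction.

(** * Commutators and associativity in modules *)

Section ModuleFormulas.
Variables (K : numFieldType) (V : vertexAlg K).
Implicit Types (M : vaModule V).

Definition adjoint_module : vaModule V := VaModule (va_adjoint (vaP V)).

HB.instance Definition _ M (a : V) n :=
  GRing.isLinear.Build K M M _ (act a n) (act_linear_r (vmP M) a n).

HB.instance Definition _ (a : V) n :=
  GRing.isLinear.Build K V V _ (nprod a n)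
    (act_linear_r (va_adjoint (vaP V)) a n).

(** The argument order makes the linearity in the algebra element available to
    the structure of linear maps. *)
Definition act_on M n (x : M) (a : V) : M := act a n x.

HB.instance Definition _ M n (x : M) :=
  GRing.isLinear.Build K V M _ (act_on n x) (act_linear_l (vmP M) n x).

Lemma actDl M n (x : M) a b : act (a + b) n x = act a n x + act b n x.
Proof. exact: (raddfD (act_on n x)). Qed.

Lemma actBl M n (x : M) a b : act (a - b) n x = act a n x - act b n x.
Proof. exact: (raddfB (act_on n x)). Qed.

Lemma actZl M n (x : M) c a : act (c *: a) n x = c *: act a n x.
Proof. exact: (linearZ_LR (act_on n x)). Qed.

Lemma act0l M n (x : M) : act 0 n x = 0.
Proof. exact: (raddf0 (act_on n x)). Qed.

Lemma act0r M (a : V) n : act a n (0 : M) = 0.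
Proof. exact: raddf0. Qed.

Lemma int_binomial0r (p : int) : int_binomial K p 0 = 1.
Proof. by rewrite /int_binomial big_ord0 fact0 divr1. Qed.

Lemma int_binomial1r (p : int) : int_binomial K p 1 = p%:~R.
Proof. by rewrite /int_binomial big_ord1 subr0 divr1. Qed.

Lemma int_binomial0S i : int_binomial K 0 i.+1 = 0.
Proof. by rewrite /int_binomial big_ord_recl subr0 !mul0r. Qed.

Lemma commutator_formula M a b (x : M) (p q : int) :
  exists N0 : nat, forall N : nat, (N0 <= N)%N ->
    act a p (act b q x) - act b q (act a p x) =
    \sum_(i < N) int_binomial K p i *: act (nprod a i%:Z b) (p + q - i%:Z) x.
Proof.
have [N0 bo] := act_borcherds (vmP M) a b x p q 0.
exists N0.+1 => -[//|N] NN.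
have := bo N.+1 (ltnW NN).
rewrite [X in _ = X -> _]big_ord_recl.
rewrite [X in _ = _ + X -> _]big1 => [|i _]; last first.
  by rewrite lift0 int_binomial0S mulr0 scale0r.
rewrite int_binomial0r mulr1 expr0 !scale1r !addr0 => <-.
by apply: eq_bigr => i _; rewrite add0r.
Qed.

Lemma associativity_formula M a b (x : M) (r q : int) :
  exists N : nat,
    act (nprod a r b) q x =
    \sum_(i < N) ((-1) ^+ i * int_binomial K r i) *:
      (act a (r - i%:Z) (act b (q + i%:Z) x)
       - (-1 : K) ^ r *: act b (q + r - i%:Z) (act a i%:Z x)).
Proof.
have [N0 bo] := act_borcherds (vmP M) a b x 0 q r.
exists N0.+1; have := bo N0.+1 (leqnSn _).
rewrite [X in X = _ -> _]big_ord_recl.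
rewrite [X in _ + X = _ -> _]big1 => [|i _]; last first.
  by rewrite lift0 int_binomial0S scale0r.
rewrite int_binomial0r scale1r !addr0 add0r => ->.
by apply: eq_bigr => i _; rewrite !add0r.
Qed.

(** Every a_(p) b_(q) x is a combination of vectors (a_(r) b)_(s) x.  In the
    Borcherds identity at (P, q, p - P), with P so large that the modes a_(P+i),
    i >= 0, kill [x], the second products disappear, and the first ones are
    a_(p-i) b_(q+i) x.  Those with i > 0 are covered by descending induction
    on [q], which starts where b_(q) x = 0. *)
Lemma act_act_in M (S : set M) (sS : is_subspace S) a b x :
  (forall r s, S (act (nprod a r b) s x)) ->
  forall p q, S (act a p (act b q x)).
Proof.
move=> Sab p q.
have [Pa Pa0] := act_truncation (vmP M) a x.
have [Nb Nb0] := act_truncation (vmP M) b x.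
have [d dq] : exists d : nat, Nb <= q + d%:Z by exists `|Nb - q|%N; lia.
elim: d p q dq => [|d IH] p q dq.
  by rewrite Nb0 ?act0r; [apply: subspace0|lia].
have [N0 /(_ N0.+1 (leqnSn _))] := act_borcherds (vmP M) a b x Pa q (p - Pa).
have a0 (i : nat) : act a (Pa + i%:Z) x = 0 by apply: Pa0; lia.
rewrite [X in _ = X -> _]big_ord_recl int_binomial0r mulr1 expr0 scale1r.
rewrite a0 act0r scaler0 [X in _ = X + _ -> _]subr0.
rewrite (_ : Pa + (p - Pa) - (@ord0 N0)%:Z = p); last by rewrite /=; lia.
rewrite (_ : q + (@ord0 N0)%:Z = q); last by rewrite /=; lia.
move=> /eqP; rewrite -subr_eq => /eqP <-.
apply: subspaceB => //; apply: subspace_sum => // i; apply: subspaceZ => //.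
rewrite a0 act0r scaler0 subr0; apply: IH; rewrite lift0; lia.
Qed.

Lemma act_comm0 M a b (x : M) p q :
  (forall i : nat, nprod a i%:Z b = 0) ->
  act a p (act b q x) = act b q (act a p x).
Proof.
move=> ab0; apply/eqP; rewrite -subr_eq0.
have [N /(_ _ (leqnn _)) ->] := commutator_formula a b x p q.
by rewrite big1 // => i _; rewrite ab0 act0l scaler0.
Qed.

Lemma act_comm_affine M a b z d :
  (forall i : nat, nprod a i%:Z b =
     if i == 0%N then z else if i == 1%N then d *: vacuum V else 0) ->
  forall (x : M) p q, act a p (act b q x) =
    act b q (act a p x) + act z (p + q) x
    + (if p + q == 0 then d * p%:~R else 0) *: x.
Proof.
move=> ope x p q; apply/eqP; rewrite -addrA addrC -subr_eq; apply/eqP.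
have [N] := commutator_formula a b x p q.
move=> /(_ N.+2 (leqW (leqnSn _))) ->.
rewrite !big_ord_recl big1 => [|i _]; last first.
  by rewrite !lift0 ope /= act0l scaler0.
have -> : nat_of_ord (lift (@ord0 N.+1) ord0) = 1%N by [].
rewrite !ope /= int_binomial0r int_binomial1r scale1r [LHS]addrA addr0.
rewrite [p + q - 0]subr0; congr (_ + _); rewrite actZl (act_vacuum (vmP M)).
rewrite subr_eq addNr; case: eqP => _; last by rewrite !scaler0 scale0r.
by rewrite scalerA mulrC.
Qed.

Lemma act0_derivation M a b (x : M) n :
  act a 0 (act b n x) = act (nprod a 0 b) n x + act b n (act a 0 x).
Proof.
apply/eqP; rewrite -subr_eq; apply/eqP.
have [N /(_ _ (leqnSn _)) ->] := commutator_formula a b x 0 n.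
rewrite big_ord_recl big1 => [|i _]; last first.
  by rewrite lift0 int_binomial0S scale0r.
by rewrite int_binomial0r scale1r !addr0 add0r.
Qed.

Definition act_kernel M (A : set V) : set M :=
  [set x | forall a n, A a -> act a n x = 0].

Definition annihilator M (X : set M) : set V :=
  [set a | forall n x, X x -> act a n x = 0].

Lemma annihilator_subspace M (X : set M) : is_subspace (annihilator X).
Proof.
split=> [n x _|c u v u0 v0 n x Xx]; first exact: act0l.
by rewrite actDl actZl u0 // v0 // scaler0 addr0.
Qed.

(** By associativity, the modes of b_(r) a are combinations of products of modes
    of [a] and [b] in either order; the order in which [b] acts first is covered
    by the stability of [X]. *)
Lemma annihilator_nprod M (X : set M) (b a : V) r :
  (forall n x, X x -> X (act b n x)) ->
  annihilator X a -> annihilator X (nprod b r a).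
Proof.
move=> Xb a0 q x Xx; have [N ->] := associativity_formula b a x r q.
rewrite big1 // => i _.
by rewrite !a0 // ?act0r ?scaler0 ?subr0 ?scaler0 //; apply: Xb.
Qed.

Lemma act_kernel_commutant M (A : set V) b :
  A `<=` commutant_set b ->
  forall n x, act_kernel (M := M) A x -> act_kernel (M := M) A (act b n x).
Proof.
by move=> Ab n x Ax a m Aa; rewrite -act_comm0 ?Ax ?act0r //; apply: Ab.
Qed.

Lemma act_kernel_ideal_submodule M (I : ideal V) :
  is_submodule (act_kernel (M := M) I).
Proof.
split=> [|b m x Ix a n Ia].
  split=> [a n _|c u v Iu Iv a n Ia]; first exact: act0r.
  by rewrite linearP /= Iu // Iv // scaler0 addr0.
apply: (@act_act_in M [set 0]) => [|r s]; first exact: zero_subspace.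
by apply: Ix; apply: (ideal_nprod_r (idealP I)).
Qed.

(** A span, encoded as an intersection of subspaces: to exclude [w] from it,
    one subspace suffices and no finite sums have to be handled. *)
Definition ideal_orbit M (I : ideal V) (w : M) : set M :=
  [set x | forall S : set M, is_subspace S ->
     (forall a n, ideal_set I a -> S (act a n w)) -> S x].

Lemma ideal_orbit_submodule M (I : ideal V) (w : M) :
  is_submodule (ideal_orbit I w).
Proof.
split=> [|b m x Ix S sS Sw].
  split=> [S sS _|c u v Iu Iv S sS Sw]; first exact: subspace0.
  by apply: sS.2; [apply: Iu|apply: Iv].
apply: (Ix [set y | S (act b m y)]) => [|a n Ia].
  exact: (preim_subspace (act b m : {linear M -> M})).
apply: act_act_in => // r s; apply: Sw.
exact: (ideal_nprod_l (idealP I)).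
Qed.

Lemma is_quot_moduleP (I : ideal V) M :
  is_quot_module I M <-> annihilates I [set: M].
Proof.
split=> [[act' [mod' act'E]] a x n Ia _|I0].
  have [ll _ _ _ _] := mod'.
  have z : quotva_proj I a = 0.
    rewrite -(raddf0 (quot_pi (ideal_sp I))); apply/quot_piP.
    by rewrite subr0.
  have l0 : act' 0 n x = 0.
    by have := ll n x (-1) 0 0; rewrite !scaleN1r oppr0 addr0 addNr.
  by rewrite -act'E z l0.
pose act' (u : quotva I) n (x : M) := act (quot_repr u) n x.
have act'E a n x : act' (quotva_proj I a) n x = act a n x.
  apply/eqP; rewrite -subr_eq0 -actBl; apply/eqP/I0 => //.
  by apply/(quot_piP (ideal_sp I)); rewrite quot_reprK.
exists act'; split=> //; have [ll lr tr va bo] := vmP M.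
split=> [n x|u n|u x|n x|u v x p q r].
- move=> c u v; rewrite -[u]quot_reprK -[v]quot_reprK -linearP.
  by rewrite !act'E ll.
- exact: lr.
- exact: tr.
- by rewrite act'E va.
- have [N0 boN] := bo (quot_repr u) (quot_repr v) x p q r.
  exists N0 => N /boN <-; apply: eq_bigr => i _; congr (_ *: _).
  exact: act'E.
Qed.

End ModuleFormulas.

(** * The filtration by words in affine generators *)

Section WordFiltration.
Variables (K : numFieldType) (V : vertexAlg K) (G : set V).

(** Modes of [G] commute up to a mode of [G] and a scalar that preserves the
    degree; this is all that the reordering of words uses of the affine Lie
    algebra. *)
Definition affine_generators := forall a b, G a -> G b ->
  exists c z (d : int -> int -> K), G z /\ forall m n (x : V),
    nprod a m (nprod b n x) =
    nprod b n (nprod a m x) + c *: nprod z (m + n) x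
    + (if m + n == 0 then d m n else 0) *: x.

Definition word (s : seq (V * int)) := forall p, p \in s -> G p.1.

Definition word_eval (s : seq (V * int)) (x : V) : V :=
  foldr (fun p y => nprod p.1 p.2 y) x s.

(** For generators of conformal weight 1, minus the conformal weight of the
    word. *)
Definition word_degree (s : seq (V * int)) : int := \sum_(p <- s) p.2.

Lemma word_degree_cons p s : word_degree (p :: s) = p.2 + word_degree s.
Proof. by rewrite /word_degree big_cons. Qed.

Lemma word_degree_cat s t :
  word_degree (s ++ t) = word_degree s + word_degree t.
Proof. by rewrite /word_degree big_cat. Qed.

(** The span of the words of conformal weight at most [D]. *)
Definition word_fil (D : int) : set V :=
  [set x | forall S, is_subspace S ->
    (forall s, word s -> - D <= word_degree s -> S (word_eval s (vacuum V))) ->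
    S x].

Lemma word_fil_subspace D : is_subspace (word_fil D).
Proof.
split=> [S sS _|c u v Fu Fv S sS Sw]; first exact: subspace0.
by apply: sS.2; [apply: Fu|apply: Fv].
Qed.

Lemma word_fil_word D s :
  word s -> - D <= word_degree s -> word_fil D (word_eval s (vacuum V)).
Proof. by move=> ws sD S sS; apply. Qed.

Lemma word_fil_mono D E : D <= E -> word_fil D `<=` word_fil E.
Proof.
by move=> DE x Fx S sS Sw; apply: Fx => // s ws sD; apply: Sw => //; lia.
Qed.

Lemma word_fil_nprod D a n x :
  G a -> word_fil D x -> word_fil (D - n) (nprod a n x).
Proof.
move=> Ga Fx; apply: (Fx [set y | word_fil (D - n) (nprod a n y)]).
  exact: (preim_subspace (nprod a n : {linear V -> V})) (word_fil_subspace _).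
move=> s ws sD; apply: (@word_fil_word _ ((a, n) :: s)).
  by move=> p; rewrite inE => /orP[/eqP -> //|]; apply: ws.
by rewrite word_degree_cons /=; lia.
Qed.

Lemma word_eval_linear s : linear (word_eval s).
Proof. by move=> c u v; elim: s => //= p s ->; rewrite linearP. Qed.

HB.instance Definition _ s :=
  GRing.isLinear.Build K V V _ (word_eval s) (word_eval_linear s).

(** A word of positive degree has a letter with positive mode.  This letter is
    moved to the right, where it kills the vacuum; each commutator produces
    shorter words of the same degree. *)
Lemma word_eval_pos : affine_generators ->
  forall s, word s -> 0 < word_degree s -> word_eval s (vacuum V) = 0.
Proof.
move=> aff s.
have [l] := ubnP (size s); elim: l s => // l IH s sl ws s0.
have [[a n] an n0] : exists2 p, p \in s & 0 < p.2.
  apply/hasP; apply: contraTT s0; rewrite -all_predC => /allP s0.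
  rewrite -leNgt /word_degree big_seq; apply: sumr_le0 => p /s0 /=.
  by rewrite leNgt.
rewrite /= in n0.
case/splitPr: an sl ws s0 => u t.
elim: t u => [|[b m] t IHt] u sl ws s0.
  rewrite /word_eval foldr_cat /= (va_creation_regular (vaP V)) ?ltW //.
  exact: raddf0 (word_eval u).
have Ga : G a by apply: (ws (a, n)); rewrite mem_cat !inE eqxx orbT.
have Gb : G b by apply: (ws (b, m)); rewrite mem_cat !inE eqxx !orbT.
have [c [z [d [Gz comm]]]] := aff a b Ga Gb.
have cat v y : word_eval (u ++ v) y = word_eval u (word_eval v y).
  exact: foldr_cat.
have wsub v :
    (forall p, p \in v -> p.1 = z \/ p \in u ++ [:: (a, n), (b, m) & t]) ->
    word v.
  by move=> H p /H [-> //|]; apply: ws.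
move: sl s0; rewrite size_cat /= word_degree_cat !word_degree_cons /= => sl s0.
rewrite cat /= comm !raddfD /= !linearZ /=.
have := IHt (rcons u (b, m)); rewrite -cats1 -catA cat /= => ->; first last.
- by rewrite word_degree_cat !word_degree_cons /=; lia.
- apply: wsub => p; rewrite !mem_cat !inE.
  by case/or4P=> ->; rewrite ?orbT; right.
- by rewrite size_cat /=; lia.
have := IH (u ++ (z, n + m) :: t); rewrite cat /= => ->; first last.
- by rewrite word_degree_cat !word_degree_cons /=; lia.
- apply: wsub => p; rewrite !mem_cat !inE => /or3P[-> |/eqP -> |-> ].
  + by right.
  + by left.
  + by rewrite !orbT; right.
- by rewrite size_cat /=; lia.
rewrite scaler0 !add0r; case: eqP => nm; last by rewrite scale0r.
rewrite -cat IH ?scaler0 //.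
- by rewrite size_cat; lia.
- by apply: wsub => p; rewrite !mem_cat !inE => /orP[] ->; rewrite ?orbT; right.
- by rewrite word_degree_cat; lia.
Qed.

Lemma word_fil_neg : affine_generators ->
  forall D x, D < 0 -> word_fil D x -> x = 0.
Proof.
move=> aff D x D0 Fx; apply: (Fx [set 0]); first exact: zero_subspace.
by move=> s ws sD; apply: word_eval_pos => //; lia.
Qed.

(** The words span a vertex subalgebra: since [G] acts on the span by
    definition, associativity and induction on the length of [a] show that the
    modes of every word [a] preserve the span. *)
Lemma word_fil_exhaustive x :
  (forall S : set V, is_subva S -> G `<=` S -> S = setT) ->
  exists D, word_fil D x.
Proof.
move=> gen; pose S := [set x | exists D, word_fil D x].
have sS : is_subspace S.
  split=> [|c u v [D Du] [E Ev]].
    by exists 0; apply: subspace0 (word_fil_subspace _).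
  exists (Num.max D E); apply: (word_fil_subspace _).2.
    by apply: word_fil_mono Du; rewrite le_max lexx.
  by apply: word_fil_mono Ev; rewrite le_max lexx orbT.
have SG a n y : G a -> S y -> S (nprod a n y).
  by move=> Ga [D Dy]; exists (D - n); apply: word_fil_nprod.
have Svac : S (vacuum V).
  by exists 0; apply: (@word_fil_word _ [::]); rewrite // /word_degree big_nil.
suff SE : S = setT by have : S x by rewrite SE.
apply: gen => [|a Ga]; last by rewrite -(va_creation (vaP V) a); apply: SG.
split=> // a n b [D Fa] Sb; move: n b Sb.
apply: (Fa [set a | forall n b, S b -> S (nprod a n b)]).
  split=> [n b _|c u v Su Sv n b Sb].
    by have /= -> := act0l (M := adjoint_module V) n b; apply: subspace0.
  rewrite (act_linear_l (va_adjoint (vaP V))).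
  by apply: sS.2; [apply: Su|apply: Sv].
move=> s ws _; elim: s ws => [|[g r] s IH] ws n b Sb /=.
  rewrite (act_vacuum (va_adjoint (vaP V))).
  by case: ifP => _ //; apply: subspace0.
have Gg : G g by apply: (ws (g, r)); rewrite inE eqxx.
have {}IH : forall n b, S b -> S (nprod (word_eval s (vacuum V)) n b).
  by apply: IH => p ps; apply: ws; rewrite inE ps orbT.
have [N /= ->] := associativity_formula (M := adjoint_module V)
  g (word_eval s (vacuum V)) b r n.
apply: subspace_sum => // i; apply: subspaceZ => //.
by apply: subspaceB => //; [|apply: subspaceZ => //]; auto.
Qed.

End WordFiltration.

(** * Ideals of the affine vertex algebra of sl2 *)

Section AffineSl2.
Variables (K : numFieldType) (k : K) (V : vertexAlg K) (e h f : V).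
Hypothesis ope : affine_sl2_ope k e h f.

Let VM := adjoint_module V.

Definition sl2_generators : set V := [set a | a = e \/ a = h \/ a = f].

Lemma sl2_affine_generators : affine_generators sl2_generators.
Proof.
have [hh he hf ef ee ff] := ope.
pose comm a b c z (d : int -> int -> K) := forall m n (x : V),
  nprod a m (nprod b n x) = nprod b n (nprod a m x) + c *: nprod z (m + n) x
    + (if m + n == 0 then d m n else 0) *: x.
have commP a b c z d : (forall i : nat, nprod a i%:Z b =
     if i == 0%N then c *: z else if i == 1%N then d *: vacuum V else 0) ->
    comm a b c z (fun m _ => d * m%:~R).
  move=> H m n x; have <- := actZl (M := VM) (m + n) x c z.
  exact: (act_comm_affine (M := VM) H).
have commC a b c z d : comm a b c z d -> comm b a (- c) z (fun m n => - d n m).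
  move=> H m n x; rewrite H [n + m]addrC scaleNr.
  have -> : (if m + n == 0 then - d n m else 0)
      = - (if m + n == 0 then d n m else 0).
    by case: ifP; rewrite ?oppr0.
  by rewrite scaleNr [X in _ = X - _]addrAC !addrK.
have Hhe : comm h e 2 e (fun m _ => 0 * m%:~R).
  by apply: commP => -[|[|i]]; rewrite he //= scale0r.
have Hhf : comm h f (- 2) f (fun m _ => 0 * m%:~R).
  by apply: commP => -[|[|i]]; rewrite hf //= ?scaleNr ?scale0r.
have Hef : comm e f 1 h (fun m _ => k * m%:~R).
  by apply: commP => -[|[|i]]; rewrite ef //= ?scale1r.
have Hhh : comm h h 0 h (fun m _ => (2 * k) * m%:~R).
  by apply: commP => -[|[|i]]; rewrite hh //= ?scale0r.
have Hee : comm e e 0 e (fun m _ => 0 * m%:~R).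
  by apply: commP => -[|[|i]]; rewrite ee //= ?scale0r.
have Hff : comm f f 0 f (fun m _ => 0 * m%:~R).
  by apply: commP => -[|[|i]]; rewrite ff //= ?scale0r.
have Ge : sl2_generators e by left.
have Gh : sl2_generators h by right; left.
have Gf : sl2_generators f by right; right.
move=> a b [->|[->|->]] [->|[->|->]].
- by do 3!eexists; split; [|exact: Hee].
- by do 3!eexists; split; [|exact: commC Hhe].
- by do 3!eexists; split; [|exact: Hef].
- by do 3!eexists; split; [|exact: Hhe].
- by do 3!eexists; split; [|exact: Hhh].
- by do 3!eexists; split; [|exact: Hhf].
- by do 3!eexists; split; [|exact: commC Hef].
- by do 3!eexists; split; [|exact: commC Hhf].
- by do 3!eexists; split; [|exact: Hff].
Qed.

Hypothesis gen : forall S : set V, is_subva S -> S e -> S h -> S f -> S = setT.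

Lemma sl2_word_fil_exhaustive x : exists D, word_fil sl2_generators D x.
Proof.
apply: word_fil_exhaustive => S sS GS.
by apply: gen => //; apply: GS; rewrite /sl2_generators /=; tauto.
Qed.

(** This is the form in which the semisimplicity of h_(0) enters: for
    eigenvalue 0 there are no generalized eigenvectors beyond the kernel. *)
Lemma h0_semisimple x : off_spectrum (nprod h 0) 0 (nprod h 0 x).
Proof.
have [hh he hf _ _ _] := ope.
pose T : {linear V -> V} := nprod h 0.
have [D Fx] := sl2_word_fil_exhaustive x.
apply: (Fx [set y | off_spectrum T 0 (T y)]).
  exact: preim_subspace (off_spectrum_subspace T 0).
move=> s ws _.
(* Words are eigenvectors because h_(0) acts as a derivation. *)
have [c Tc] : exists c,
    T (word_eval s (vacuum V)) = c *: word_eval s (vacuum V).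
  elim: s ws => [|[g n] s IH] ws /=.
    by exists 0; rewrite scale0r; apply: (va_creation_regular (vaP V)).
  have [c IHc] : exists c,
      T (word_eval s (vacuum V)) = c *: word_eval s (vacuum V).
    by apply: IH => p ps; apply: ws; rewrite inE ps orbT.
  have [l Tg] : exists l, nprod h 0 g = l *: g.
    have /= [-> | [->|->]] : sl2_generators (g, n).1.
    - by apply: ws; rewrite inE eqxx.
    - by exists 2; rewrite (he 0%N).
    - by exists 0; rewrite (hh 0%N) scale0r.
    - by exists (- 2); rewrite (hf 0%N) scaleNr.
  exists (l + c); rewrite scalerDl.
  have /= -> := act0_derivation (M := VM) h g (word_eval s (vacuum V)) n.
  congr (_ + _); first by rewrite Tg; apply: (actZl (M := VM)).
  by rewrite -[nprod h 0 _]/(T _) IHc; exact: linearZ_LR.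
case: (eqVneq c 0) => [c0|c0] /=.
  by rewrite Tc c0 scale0r; apply: subspace0; exact: off_spectrum_subspace.
exists [:: c]; first by rewrite inE eq_sym.
by rewrite /= {1}Tc linearZ_LR /= subrr.
Qed.

Lemma h_heisenberg m n (x : V) : nprod h m (nprod h n x) =
  nprod h n (nprod h m x) + (if m + n == 0 then (2 * k) * m%:~R else 0) *: x.
Proof.
have hh (i : nat) : nprod h i%:Z h =
    if i == 0%N then 0 else if i == 1%N then (2 * k) *: vacuum V else 0.
  by rewrite (ope_hh ope); case: i => [|[|i]].
have /= -> := act_comm_affine (M := VM) hh x m n.
by rewrite [X in _ + X + _](act0l (M := VM)) addr0.
Qed.

(** The Heisenberg reduction inside [I], with the annihilator of [X] as the
    stable subspace to be reached. *)
Lemma weight0_annihilates (k0 : k != 0) (M : vaModule V) (I : ideal V)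
    (X : set M) a :
  (forall n x, X x -> X (act h n x)) ->
  (forall b, ideal_set I b -> commutant_set h b -> annihilator X b) ->
  ideal_set I a -> nprod h 0 a = 0 -> annihilator X a.
Proof.
move=> Xh XJ Ia h0a.
have [D Fa] := sl2_word_fil_exhaustive a.
have k20 : 2 * k != 0 by rewrite mulf_neq0 // pnatr_eq0.
have Gh : sl2_generators h by right; left.
apply: (heisenberg_reduction (T := fun n => nprod h n : {linear V -> V}) k20
  h_heisenberg _ _ _ _ _ _ _ _ Fa Ia h0a).
- by move=> E; apply: word_fil_subspace.
- by move=> E n x; apply: word_fil_nprod.
- exact: word_fil_neg sl2_affine_generators.
- exact: ideal_subspace (idealP I).
- by move=> n x; apply: (ideal_nprod_l (idealP I)).
- exact: annihilator_subspace.
- by move=> n x; apply: annihilator_nprod => m y; apply: Xh.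
- by move=> b Ib hb; apply: XJ.
Qed.

(** If I w were nonzero, then the vectors a_(n) w with [a] in [I] would span M;
    but they all lie in the subspace [S] of vectors without component of
    eigenvalue [c], which excludes [w]. *)
Lemma ideal_annihilates_irreducible (k0 : k != 0) (M : vaModule V)
    (I : ideal V) (w : M) c :
  irreducible M -> w != 0 -> act h 0 w = c *: w ->
  (forall a n, ideal_set I a -> commutant_set h a -> act a n w = 0) ->
  annihilates I [set: M].
Proof.
move=> [_ irr] w0 hw Jw.
have Iw0 (a : V) n : ideal_set I a -> nprod h 0 a = 0 -> act a n w = 0.
  move=> Ia h0a; pose J : set V := [set b | ideal_set I b /\ commutant_set h b].
  suff /(_ n w) : annihilator (act_kernel (M := M) J) a.
    by apply=> b m [Ib hb]; apply: Jw.
  apply: (weight0_annihilates k0 (I := I)) => // [m x|b Ib hb m x].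
    by apply: act_kernel_commutant => b [].
  by apply.
pose T : {linear M -> M} := act h 0.
pose S := off_spectrum T c.
have sS : is_subspace S := off_spectrum_subspace T c.
have nSw : ~ S w by move/(off_spectrum_eigen hw) => /eqP; apply/negP.
have SI (a : V) n : ideal_set I a -> S (act a n w).
  move=> Ia; have [a0 [a' [-> Ia0 ha0 [s s0 sa']]]] :=
    off_spectrum_split (T := nprod h 0 : {linear V -> V})
      (ideal_subspace (idealP I)) (@ideal_nprod_l _ _ _ (idealP I) h 0)
      Ia (h0_semisimple a).
  (* Eigenvalues on V and M differ by that of [w], hence the shift by [c]. *)
  rewrite actDl Iw0 // add0r; exists (map (fun l => l + c) s).
    apply: contraNN s0 => /mapP[l ls /esym/(canRL (addrK c))].
    by rewrite subrr => <-.
  suff -> : root_prod T (map (fun l => l + c) s) (act a' n w) =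
      act (root_prod (nprod h 0 : {linear V -> V}) s a') n w.
    by rewrite sa' act0l.
  elim: s {s0 sa'} => //= l s ->.
  rewrite act0_derivation hw linearZ_LR /= actBl actZl scalerDl opprD.
  by rewrite addrACA subrr addr0.
have Iw a n : ideal_set I a -> act a n w = 0.
  case: (irr _ (ideal_orbit_submodule I w)) => orb Ia.
    suff : ideal_orbit I w (act a n w) by rewrite orb.
    by move=> S' _; apply.
  have : ideal_orbit I w w by rewrite orb.
  by move/(_ S sS SI).
case: (irr _ (act_kernel_ideal_submodule M I)) => ker a x n Ia _.
  have : act_kernel (M := M) I w by move=> b m Ib; apply: Iw.
  by rewrite ker => /eqP; rewrite (negbTE w0).
have : act_kernel (M := M) I x by rewrite ker.
exact.
Qed.

End AffineSl2.

Theorem proposition3 (R : realType) (k : R[i])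
    (k_neq0 : k != 0) (k_admissible : admissible k)
    (V : vertexAlg R[i]) (e h f : V)
    (V_universal : is_universal_affine_sl2 k e h f)
    (I : ideal V) (I_maximal : is_maximal_ideal I)
    (M : vaModule V) (M_irreducible : irreducible M)
    (M_weight : weight_module h M)
    (w : M) (w_neq0 : w != 0) (w_highest : heisenberg_highest h w) :
  let N := commutant h in
  let J := ideal_subva I N in
  let L := @generated_submodule _ _ (res_module N M) w in
  (annihilates J L <-> annihilates I [set: M]) /\
  (is_quot_module J (submodule_mod L) <-> is_quot_module I M).
Proof.
move=> N J L.
have [ope gen _] := V_universal.
have [_ [c hw]] := w_highest.
have main : annihilates J L <-> annihilates I [set: M].
  split=> [JL|IM a x n Ja _]; last exact: IM.
  apply: (ideal_annihilates_irreducible ope gen k_neq0 M_irreducible w_neq0 hw).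
  move=> a n Ia ha.
  apply: (JL (sub_elt (S := subva_sp N) ha) w n) => //.
have sub : annihilates J [set: submodule_mod L] <-> annihilates J L.
  split=> [JL a x n Ja Lx|JL a x n Ja _]; last first.
    by apply: val_inj; apply: JL => //; apply: sub_valP x.
  by have /(congr1 val) := JL a (sub_elt (S := submodule_sp L) Lx) n Ja Logic.I.
split; first exact: main.
apply: iff_trans (is_quot_moduleP _ _) _; apply: iff_trans sub _.
exact: iff_trans main (iff_sym (is_quot_moduleP _ _)).
Qed.
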